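(* Let $S$ be an $E$-dense semigroup, let $(X,s)$ be an $S$-cryptosystem and let $x\in X$. Then 1. $K(s,x)$ is $\omega_{\mathcal M}$-closed; 2. $\left(S_xW(s)S_{sx}\right)\omega_{\mathcal M}\subseteq K(s,x)$; 3. if $E$ is a band then $\left(S_xW(s)S_{sx}\right)\omega=K(s,x)$; 4. if $S$ is an inverse semigroup then $K(s,x)=\left(S_xs^{-1}\right)\omega$.
   Context: For a semigroup $S$, $E=E(S)$ is its set of idempotents and $W(s)=\{s'\in S\mid s'ss'=s'\}$. $S$ is $E$-dense if for every $s\in S$ there are $t,u\in S$ with $ts\in E$ and $su\in E$ (equivalently $W(s)\neq\emptyset$ for all $s$). $E$ is a band means $E$ is a subsemigroup of $S$. The natural (Mitsch) partial order on any semigroup: $a\le_{\mathcal M}b$ iff there exist $x,y\in S$ with $a=xb=by$ and $xa=ay=a$ (as a partial order it is reflexive, i.e. $x,y$ may be taken in $S^1$). When $E$ is a band, a further partial order is: $s\le t$ iff $s=t$ or there are $e,f\in E$ with $s=te=ft$. For $A\subseteq S$, $A\omega_{\mathcal M}=\{s\in S\mid a\le_{\mathcal M}s\text{ for some }a\in A\}$ and $A\omega=\{s\in S\mid a\le s\text{ for some }a\in A\}$; $A$ is $\omega_{\mathcal M}$-closed if $A=A\omega_{\mathcal M}$. A (total, left) $S$-act is a nonempty set $X$ with a map $S\times X\to X$, $(s,x)\mapsto sx$, with $(st)x=s(tx)$ for all $s,t\in S$, $x\in X$ (and $1x=x$ if $S$ is a monoid). It is cancellative if for all $s\in S$, $x,y\in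 X$, $sx=sy$ implies $x=y$. An $S$-cryptosystem $(X,s)$ consists of a cancellative total $S$-act $X$ and an element $s\in S$. For $y\in X$, $S_y=\{t\in S\mid ty=y\}$. The decrypt key space is $K(s,x)=\{t\in S\mid ts\in S_x\}$. Products of subsets of $S$ are elementwise: $ABC=\{abc\mid a\in A,b\in B,c\in C\}$. In an inverse semigroup, $s^{-1}$ is the unique inverse of $s$. *)

(* Defs.v *)
From mathcomp Require Import all_boot monoid.
From mathcomp Require Import boolp classical_sets.

Set Implicit Arguments.
Unset Strict Implicit.
Unset Printing Implicit Defensive.

Local Open Scope classical_set_scope.
Local Open Scope group_scope.

Section Semigroups.
Variable S : semigroupType.
Implicit Types (a b e f s t x y : S) (A B : set S).

Definition idem : set S := [set e | e * e = e].

Definition weak_inverses s : set S := [set s' | s' * s * s' = s'].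

Definition inverses s : set S :=
  [set s' | s * s' * s = s /\ s' * s * s' = s'].

Definition E_dense : Prop :=
  forall s, exists t u, idem (t * s) /\ idem (s * u).

Definition E_band : Prop := forall e f, idem e -> idem f -> idem (e * f).

Definition inverse_semigroup : Prop := forall s, exists! s', inverses s s'.

Definition is_identity e : Prop := forall s, e * s = s /\ s * e = s.

(* The disjunct [a = b] accounts for multipliers taken in S^1: if one of the
   multipliers is the adjoined identity, the defining equations give a = b. *)
Definition mitsch_le a b : Prop :=
  a = b \/ exists x y, [/\ a = x * b, a = b * y, x * a = a & a * y = a].

Definition idem_le s t : Prop :=
  s = t \/ exists e f, [/\ idem e, idem f, s = t * e & s = f * t].

Definition up_closure (le : S -> S -> Prop) A : set S :=
  [set s | exists2 a, A a & le a s].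

Definition omegaM A : set S := up_closure mitsch_le A.

(* This relation is only known to be a partial order when E is a band. *)
Definition omega A : set S := up_closure idem_le A.

Definition omegaM_closed A : Prop := A = omegaM A.

Definition prod_set A B : set S := [set a * b | a in A & b in B].

End Semigroups.

Arguments E_dense : clear implicits.
Arguments E_band : clear implicits.
Arguments inverse_semigroup : clear implicits.

(* [act_id] is vacuous unless S has an identity element. *)
Record sact (S : semigroupType) := SAct {
  carrier :> Type;
  act : S -> carrier -> carrier;
  act_nonempty : inhabited carrier;
  act_mul : forall (s t : S) (x : carrier), act (s * t) x = act s (act t x);
  act_id : forall e : S, is_identity e -> forall x : carrier, act e x = x
}.

Arguments act {S X} s x : rename.

Definition cancellative (S : semigroupType) (X : sact S) : Prop :=
  forall (s : S) (x y : X), act s x = act s y -> x = y.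

Record cryptosystem (S : semigroupType) := Cryptosystem {
  space :> sact S;
  key : S;
  space_cancellative : cancellative space
}.

Definition stab (S : semigroupType) (X : sact S) (y : X) : set S :=
  [set t | act t y = y].

Definition decrypt_keys (S : semigroupType) (X : sact S) (s : S) (x : X) :
  set S := [set t | stab x (t * s)].

(* Main.v *)
Require Import Defs.
From mathcomp Require Import all_boot monoid.
From mathcomp Require Import boolp classical_sets.

Local Open Scope classical_set_scope.

(** On a cancellative act the algebra of S is seen through two facts: every
    idempotent acts as the identity ([idem_act]), and two elements comparable
    for the Mitsch order act in the same way ([mitsch_le_act]).  Since
    membership of t in K(s,x) depends only on the action of t, the set K(s,x)
    is closed upwards; and an element a w b of S_x W(s) S_(sx) sends sx to x,
    because w s is idempotent.  The order [idem_le] is contained in the Mitsch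
    order, so all the inclusions into K(s,x) follow.

    Conversely, let t be in K(s,x), let w be a weak inverse of s and t' one of
    t.  Then ts fixes x, while t't is idempotent and so fixes sx; hence
    (ts) w (t't) lies in S_x W(s) S_(sx).  This element is the restriction
    t e (t't) of t by the idempotent e = sw, and it lies below t when the
    idempotents form a band ([restriction_idem_le]).  In an inverse semigroup
    the idempotents commute, so with t' the inverse of t this restriction is
    simply te = (ts) s^-1. *)

Section CancellativeActs.
Local Open Scope group_scope.
Variables (S : semigroupType) (X : sact S).
Hypothesis cancX : cancellative X.

Lemma idem_act (e : S) (y : X) : idem e -> act e y = y.
Proof. by move=> ee; apply: (cancX e); rewrite -act_mul ee. Qed.

(** If a = ub = ua, then u sends ay and by to the same point. *)
Lemma mitsch_le_act (a b : S) (y : X) : mitsch_le a b -> act a y = act b y.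
Proof.
case=> [-> // | [u [v [aub _ uaa _]]]].
by apply: (cancX u); rewrite -!act_mul uaa -aub.
Qed.

Lemma decrypt_keys_omegaM_closed (s : S) (x : X) :
  omegaM_closed (decrypt_keys s x).
Proof.
apply/seteqP; split=> t; first by move=> Kt; exists t => //; left.
case=> a Ka /mitsch_le_act at_.
by move: Ka; rewrite /decrypt_keys /stab /= !act_mul at_.
Qed.

(** Weak inverses undo the encryption: ws is idempotent, so it fixes x. *)
Lemma weak_inverse_act (s w : S) (x : X) :
  weak_inverses s w -> act w (act s x) = x.
Proof.
by move=> ws; rewrite -act_mul idem_act // /idem /= mulgA ws.
Qed.

End CancellativeActs.

Section IdempotentOrder.
Local Open Scope group_scope.
Variable S : semigroupType.
Implicit Types (a b e f s t w : S) (A B : set S).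

Lemma idem_le_mitsch a b : idem_le a b -> mitsch_le a b.
Proof.
case=> [-> | [e [f [ee ff abe afb]]]]; [by left | right].
by exists f, e; split=> //; [rewrite afb mulgA ff | rewrite abe -mulgA ee].
Qed.

Lemma omega_sub_omegaM A : omega A `<=` omegaM A.
Proof. by move=> t [a Aa /idem_le_mitsch at_]; exists a. Qed.

Lemma omegaM_mono A B : A `<=` B -> omegaM A `<=` omegaM B.
Proof. by move=> AB t [a /AB Ba at_]; exists a. Qed.

Lemma idem_mul_weak_inverse s w : weak_inverses s w -> idem (s * w).
Proof. by move=> ws; rewrite /idem /= -mulgA [w * _]mulgA ws. Qed.

Lemma idem_weak_inverse_mul s w : weak_inverses s w -> idem (w * s).
Proof. by move=> ws; rewrite /idem /= mulgA ws. Qed.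

Lemma E_dense_weak_inverse : E_dense S -> forall s, exists w, weak_inverses s w.
Proof.
move=> dS s; have [t [_ [tsts _]]] := dS s.
(* For ts idempotent, t itself need not be a weak inverse of s, but tst is. *)
exists (t * s * t); rewrite /weak_inverses /=.
by move: tsts; rewrite /idem /= !mulgA => tsts; rewrite !tsts.
Qed.

(** The right multiplier is the product e(wt) of two idempotents.  The left one
    is the conjugate tew: since w = (wt)w, its square is t(e(wt))(e(wt))w, so it
    is idempotent because e(wt) is. *)
Lemma restriction_idem_le t w e :
  E_band S -> weak_inverses t w -> idem e -> idem_le (t * e * (w * t)) t.
Proof.
move=> bS wt ee; have ewt := bS _ _ ee (idem_weak_inverse_mul _ _ wt).
right; exists (e * (w * t)), (t * e * w); split=> //; last by rewrite !mulgA.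
  have tewE : t * e * w = t * (e * (w * t)) * w.
    by rewrite -[RHS]mulgA -[e * _ * w]mulgA wt mulgA.
  rewrite /idem /= {2}tewE [RHS]tewE -[in RHS]ewt.
  by rewrite !mulgA.
by rewrite !mulgA.
Qed.

End IdempotentOrder.

Section InverseSemigroups.
Local Open Scope group_scope.
Variable S : semigroupType.
Hypothesis iS : inverse_semigroup S.
Implicit Types (e f s u v : S).

Lemma inverses_unique s u v : inverses s u -> inverses s v -> u = v.
Proof. by have [w [_ wU]] := iS s; move=> /wU <- /wU <-. Qed.

Lemma idem_inverses e : idem e -> inverses e e.
Proof. by rewrite /idem /inverses /= => ee; rewrite !ee. Qed.

(** If z is the inverse of ef, then so is fze, so z = fze, and this form makes z
    idempotent.  Thus z is its own inverse; as ef is also an inverse of z,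
    ef = z. *)
Lemma inverse_semigroup_band : E_band S.
Proof.
move=> e f ee ff; have [z [[efz zef] zU]] := iS (e * f).
have zE : z = f * z * e.
  apply: zU; split.
    transitivity (e * (f * f) * z * (e * e) * f); first by rewrite !mulgA.
    by rewrite ee ff -[RHS]efz !mulgA.
  transitivity (f * (z * ((e * e) * (f * f)) * z) * e); first by rewrite !mulgA.
  by rewrite ee ff zef.
have zz : idem z.
  rewrite /idem /= [in LHS]zE [RHS]zE -{3}zef.
  by rewrite !mulgA.
suff -> : e * f = z by [].
by apply: (@inverses_unique z); [split | apply: idem_inverses].
Qed.

(** Both ef and fe are inverses of ef. *)
Lemma inverse_semigroup_idem_comm e f : idem e -> idem f -> e * f = f * e.
Proof.
move=> ee ff.
have ef := inverse_semigroup_band _ _ ee ff.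
have fe := inverse_semigroup_band _ _ ff ee.
apply: (@inverses_unique (e * f)); first exact: idem_inverses.
split.
  transitivity (e * (f * f) * (e * e) * f); first by rewrite !mulgA.
  by rewrite ee ff -[RHS]ef !mulgA.
transitivity (f * (e * e) * (f * f) * e); first by rewrite !mulgA.
by rewrite ee ff -[RHS]fe !mulgA.
Qed.

Lemma inverse_mul_idem_le t e : idem e -> idem_le (t * e) t.
Proof.
move=> ee; have [t' [[tt't t'tt'] _]] := iS t.
suff -> : t * e = t * e * (t' * t).
  by apply: restriction_idem_le => //; apply: inverse_semigroup_band.
rewrite -mulgA (inverse_semigroup_idem_comm _ _ ee) ?mulgA ?tt't //.
exact: idem_weak_inverse_mul.
Qed.

End InverseSemigroups.

Theorem theorem3p6 (S : semigroupType) (hS : E_dense S)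
    (C : cryptosystem S) (x : C) :
  let s := key C in
  let K := decrypt_keys s x in
  let P := prod_set (prod_set (stab x) (weak_inverses s)) (stab (act s x)) in
  [/\ omegaM_closed K,
      omegaM P `<=` K,
      E_band S -> omega P = K
    & inverse_semigroup S ->
      forall s' : S, inverses s s' ->
        K = omega (prod_set (stab x) [set s'])].
Proof.
move=> s K P; have cX := @space_cancellative _ C.
have KM : omegaM_closed K by apply: decrypt_keys_omegaM_closed.
have PK : P `<=` K.
  move=> _ [_ [a ax [w ws <-]] [b bsx <-]].
  by rewrite /K /decrypt_keys /stab /= !act_mul bsx (weak_inverse_act _ _ cX _ _ _ ws).
have PMK : omegaM P `<=` K by rewrite KM; apply: omegaM_mono.
split=> // [bS | iS s' s's]; apply/seteqP; split.
- by move=> t /omega_sub_omegaM /PMK.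
- move=> t Kt; have [w ws] := E_dense_weak_inverse _ hS s.
  have [t' t't] := E_dense_weak_inverse _ hS t.
  exists (t * s * w * (t' * t))%g.
    exists (t * s * w)%g; first by exists (t * s)%g => //; exists w.
    exists (t' * t)%g => //; apply: idem_act => //.
    exact: idem_weak_inverse_mul.
  rewrite -[(t * s * w)%g]mulgA; apply: restriction_idem_le => //.
  exact: idem_mul_weak_inverse.
- move=> t Kt; exists (t * s * s')%g.
    by exists (t * s)%g => //; exists s'.
  rewrite -mulgA; apply: inverse_mul_idem_le => //.
  by apply: idem_mul_weak_inverse; case: s's.
- move=> t /omega_sub_omegaM; rewrite KM; apply: omegaM_mono.
  move=> _ [a ax [_ -> <-]].
  have [_ ws] := s's.
  by rewrite /K /decrypt_keys /stab /= !act_mul (weak_inverse_act _ _ cX _ _ _ ws).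
Qed.
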